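(* Let $\mathfrak{a}_0,\mathfrak{b}_0$ be applications with $\mathfrak{a}_0\overset{JT}{\sim}\mathfrak{b}_0$, let $1\le m<n$, and suppose there is $k$ with $m+1\le k\le n$ and $f^0_k\neq 0$, where $f^0_k$ is the probability $\mathfrak{a}_0$ assigns to $\alpha^k$. Then there exist two infinite sequences of applications $\mathfrak{a}_0,\mathfrak{a}_1,\dots$ and $\mathfrak{b}_0,\mathfrak{b}_1,\dots$ (starting from the given $\mathfrak{a}_0,\mathfrak{b}_0$) such that for all $i$, $\mathfrak{a}_{i+1}\overset{AT}{\underset{m}{\leadsto}}\mathfrak{a}_i$ and $\mathfrak{b}_{i+1}\overset{AT}{\underset{m}{\leadsto}}\mathfrak{b}_i$, and for all $i\neq 0$, $\mathfrak{a}_i$ is not Justifiably Trustworthy w.r.t. $\mathfrak{b}_i$.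
   Context: Fix an atomic target variable $a$ whose possible atomic values $\alpha^1,\dots,\alpha^n$ are exhaustive and pairwise mutually exclusive. An application $\mathfrak{a}$ of an ML system (a Training Set, a Learning Algorithm, a fixed input list of value attributions $\sigma$, and the target $a$) is identified with its output probability vector $(f_1,\dots,f_n)$, $f_i\in[0,1]$, $\sum_i f_i=1$, where $f_i$ is the probability assigned to $\alpha^i$; every such vector is the output of some application. For $\mathfrak{a}$ with $(f_i)$, $\mathfrak{b}$ with $(g_i)$ and $1\le m\le n$: $\mathfrak{a}\overset{JT}{\sim}\mathfrak{b}$ iff $f_i=g_i$ for all $i$; $\mathfrak{a}\overset{AT}{\underset{m}{\leadsto}}\mathfrak{b}$ iff $f_i\ge g_i$ for all $i\le m$. *)

(* Defs.v *)
From mathcomp Require Import all_boot all_order all_algebra.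
From mathcomp Require Import reals.

Set Implicit Arguments.
Unset Strict Implicit.
Unset Printing Implicit Defensive.

Import Order.TTheory GRing.Theory Num.Theory.
Local Open Scope ring_scope.

(* The possible values alpha^1, ..., alpha^n of the target variable are indexed
   by 'I_n: the ordinal i stands for alpha^(i+1).  An application of the ML
   system is identified with its output probability vector. *)
Record application (R : realType) (n : nat) := Application {
  prob :> {ffun 'I_n -> R};
  prob_itv : forall i, 0 <= prob i <= 1;
  prob_sum1 : \sum_i prob i = 1
}.

Definition justifiably_trustworthy (R : realType) (n : nat)
    (a b : application R n) : Prop :=
  forall i : 'I_n, a i = b i.

(* As ordinals start at 0, the first m values alpha^1, ..., alpha^m are the
   ordinals i < m. *)
Definition at_leads (R : realType) (n m : nat)
    (a b : application R n) : Prop :=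
  forall i : 'I_n, (i < m)%N -> b i <= a i.

(* Main.v *)
(** Replace [b0] from step 1 on by the application that moves the whole
    (nonzero) probability of [k >= m] onto the first value: no probability below
    [m] decreases, while that of the first value strictly exceeds its value
    under [a0].  Both sequences can then stay constant from step 1 on, since
    [at_leads] is reflexive. *)

Require Import Defs.
From mathcomp Require Import all_boot all_order all_algebra.
From mathcomp Require Import reals.

Import Order.TTheory GRing.Theory Num.Theory.
Local Open Scope ring_scope.

(** A nonnegative entry is at most the total 1, so the upper bound in [prob_itv] is automatic. *)
Lemma application_of_nonneg (R : realType) (n : nat) (f : {ffun 'I_n -> R})
    (f_ge0 : forall i, 0 <= f i) (f_sum1 : \sum_i f i = 1) :
  exists a : application R n, prob a = f.
Proof.
have f_itv i : 0 <= f i <= 1.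
  by rewrite f_ge0 -f_sum1 (bigD1 i) //= lerDl sumr_ge0.
by exists (Application f_itv f_sum1).
Qed.

(** Mass is subtracted only at [k], where it cancels [a k] itself, so entries stay nonnegative; the
    two corrections have equal sums. The Boolean multiplicities also cover [j = k]. *)
Lemma exists_transfer (R : realType) (n : nat) (a : application R n)
    (j k : 'I_n) :
  exists b : application R n,
    forall i, b i = a i + a k *+ (i == j) - a k *+ (i == k).
Proof.
have a_ge0 i : 0 <= a i by case/andP: (prob_itv a i).
have sum_delta l : \sum_i a k *+ (i == l) = a k.
  rewrite (bigD1 l) //= eqxx big1 ?addr0 // => i /negPf il.
  by rewrite il.
have [||b bE] := application_of_nonneg R n
    [ffun i => a i + a k *+ (i == j) - a k *+ (i == k)].
- move=> i; rewrite ffunE; have [->|_] := eqVneq i k.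
    by rewrite mulr1n addrAC subrr add0r mulrn_wge0.
  by rewrite mulr0n subr0 addr_ge0 ?mulrn_wge0.
- under eq_bigr do rewrite ffunE.
  by rewrite sumrB big_split /= !sum_delta addrK prob_sum1.
by exists b => i; rewrite bE ffunE.
Qed.

Theorem mainTheorem2 (R : realType) (n m : nat) (a0 b0 : application R n)
    (hJT : justifiably_trustworthy a0 b0)
    (hm : (1 <= m < n)%N)
    (hk : exists k : 'I_n, (m <= k)%N /\ a0 k <> 0) :
  exists a b : nat -> application R n,
    [/\ a 0%N = a0,
        b 0%N = b0,
        forall i : nat, at_leads m (a i.+1) (a i),
        forall i : nat, at_leads m (b i.+1) (b i)
      & forall i : nat, i <> 0%N -> ~ justifiably_trustworthy (a i) (b i)].
Proof.
have [k [le_mk ak_neq0]] := hk.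
have [m_gt0 lt_mn] := andP hm.
pose j := Ordinal (ltn_trans m_gt0 lt_mn).
have [b1 b1E] := exists_transfer R n b0 j k.
(* Below [m] nothing is subtracted; this applies to [j] too, as [0 < m]. *)
have lt_neqk (i : 'I_n) : (i < m)%N -> (i == k) = false.
  by move=> lt_im; apply/eqP => eq_ik; rewrite eq_ik ltnNge le_mk in lt_im.
exists (fun=> a0), (fun i => if i is 0%N then b0 else b1); split=> //.
- by move=> i l _.
- by move=> [|i] l lt_lm //=; rewrite b1E lt_neqk // subr0 lerDl mulrn_wge0 //;
    case/andP: (prob_itv b0 k).
(* Agreement at [j] would read [b0 j = b0 j + b0 k], forcing [a0 k = b0 k = 0]. *)
- move=> [|i] // _ /(_ j); rewrite b1E lt_neqk // eqxx subr0 mulr1n hJT.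
  by rewrite -[LHS]addr0 => /addrI /esym b0k; apply: ak_neq0; rewrite hJT.
Qed.
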